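(* Let $\Omega\subset\mathbb{R}^2$ be open (identified with an open subset of $LC_2$ via $(x,y)\leftrightarrow xI+yE$), and let $f(L)=f(xI+yE)=u(x,y)I+v(x,y)E$ be an $LC_2$-valued function on $\Omega$ with $u,v$ real-valued. If $f$ is analytic (holomorphic in the sense of $LC_2$) in $\Omega$, then the first-order partial derivatives of $u$ and $v$ exist and satisfy the Cauchy–Riemann type equations $$u_x=v_y,\qquad u_y=v_x$$ in $\Omega$.
   Context: $\mathbb{P}_2$ is the real vector space of all functions $g:\mathbb{R}\to\mathbb{R}$ with $g(t+2)=g(t)$ for all $t$. $I$ is the identity operator and $E$ the unit shift $(Eg)(t)=g(t+1)$ on $\mathbb{P}_2$, so $E^2=I$. $LC_2=\{xI+yE: x,y\in\mathbb{R}\}$, with multiplication $(x_1I+y_1E)(x_2I+y_2E)=(x_1x_2+y_1y_2)I+(x_1y_2+x_2y_1)E$ and norm $|xI+yE|=\sqrt{x^2+y^2}$; $xI+yE$ is invertible exactly when $x^2-y^2\ne0$, and $LC_2^*$ denotes the set of invertible elements. A function $f$ defined near $L_0=x_0I+y_0E$ is differentiable at $L_0$ (in the sense of $LC_2$) if the limit $f'(L_0)=\lim_{L\to L_0}(f(L)-f(L_0))(L-L_0)^{-1}$ exists, where $L\to L_0$ along any path which (apart from $L_0$) does not meet the set $|y-y_0|=|x-x_0|$, i.e. with $L-L_0\in LC_2^*$. $f$ is holomorphic in the sense of $LC_2$ in an open set if it is differentiable in this sense at each of its points. *)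

(* Defs.v *)
From HB Require Import structures.
From mathcomp Require Import all_boot all_order all_algebra.
From mathcomp Require Import ring lra.
From mathcomp Require Import all_classical all_reals all_analysis.

Set Implicit Arguments.
Unset Strict Implicit.
Unset Printing Implicit Defensive.

Import Order.TTheory GRing.Theory Num.Theory.
Import numFieldNormedType.Exports.

Local Open Scope classical_set_scope.
Local Open Scope ring_scope.

(* [Lc x y] stands for the operator x I + y E on the 2-periodic functions;
   [lc_op] below gives the operator itself, and [lc_op_inj], [lc_opD],
   [lc_opZ], [lc_opM] show that the coordinates represent it faithfully.
   A record, rather than R * R, is used because the product type carries the
   componentwise multiplication and the sup norm. *)
Record LC2 (R : Type) : Type := Lc { coordI : R; coordE : R }.

Definition LC2_to_pair (R : Type) (L : LC2 R) : R * R := (coordI L, coordE L).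
Definition LC2_of_pair (R : Type) (p : R * R) : LC2 R := Lc p.1 p.2.

Lemma LC2_to_pairK (R : Type) : cancel (@LC2_to_pair R) (@LC2_of_pair R).
Proof. by case. Qed.

Lemma LC2_of_pairK (R : Type) : cancel (@LC2_of_pair R) (@LC2_to_pair R).
Proof. by case. Qed.

HB.instance Definition _ (R : choiceType) :=
  Choice.copy (LC2 R) (can_type (@LC2_to_pairK R)).

Section Algebra.
Variable R : realType.
Implicit Types (L M N : LC2 R) (a b x y : R).

Definition lc_zero : LC2 R := Lc 0 0.
Definition lcI : LC2 R := Lc 1 0.
Definition lcE : LC2 R := Lc 0 1.
Definition lc_opp L := Lc (- coordI L) (- coordE L).
Definition lc_add L M := Lc (coordI L + coordI M) (coordE L + coordE M).
Definition lc_scale a L := Lc (a * coordI L) (a * coordE L).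
Definition lc_mul L M :=
  Lc (coordI L * coordI M + coordE L * coordE M)
     (coordI L * coordE M + coordI M * coordE L).
Definition lc_norm L : R := Num.sqrt (coordI L ^+ 2 + coordE L ^+ 2).
Definition lc_unit : pred (LC2 R) :=
  fun L => coordI L ^+ 2 - coordE L ^+ 2 != 0.
Definition lc_inv L : LC2 R :=
  if lc_unit L then
    let d := coordI L ^+ 2 - coordE L ^+ 2 in Lc (coordI L / d) (- coordE L / d)
  else L.

Fact lc_addA : associative lc_add.
Proof. by move=> [a b] [c d] [e g]; rewrite /lc_add /= !addrA. Qed.
Fact lc_addC : commutative lc_add.
Proof. by move=> [a b] [c d]; congr Lc; exact: addrC. Qed.
Fact lc_add0 : left_id lc_zero lc_add.
Proof. by move=> [a b]; rewrite /lc_add /= !add0r. Qed.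
Fact lc_addN : left_inverse lc_zero lc_opp lc_add.
Proof. by move=> [a b]; rewrite /lc_add /= !addNr. Qed.

HB.instance Definition _ :=
  GRing.isZmodule.Build (LC2 R) lc_addA lc_addC lc_add0 lc_addN.

Fact lc_mulA : associative lc_mul.
Proof. by move=> [a b] [c d] [e g]; congr Lc => /=; ring. Qed.
Fact lc_mulC : commutative lc_mul.
Proof. by move=> [a b] [c d]; congr Lc => /=; ring. Qed.
Fact lc_mul1 : left_id lcI lc_mul.
Proof. by move=> [a b]; congr Lc => /=; ring. Qed.
Fact lc_mulDl : left_distributive lc_mul lc_add.
Proof. by move=> [a b] [c d] [e g]; congr Lc => /=; ring. Qed.
Fact lc_one_neq0 : lcI != 0 :> LC2 R.
Proof. by apply/eqP => -[] /eqP; rewrite oner_eq0. Qed.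

HB.instance Definition _ := GRing.Zmodule_isComNzRing.Build (LC2 R)
  lc_mulA lc_mulC lc_mul1 lc_mulDl lc_one_neq0.

Fact lc_mulV : {in lc_unit, left_inverse 1 lc_inv *%R}.
Proof.
move=> [a b]; rewrite unfold_in /lc_inv /lc_unit /= => uL; rewrite uL.
by congr Lc => /=; field.
Qed.
Fact lc_unitP : forall L M, M * L = 1 -> lc_unit L.
Proof.
move=> [a b] [c d] [e1 e2]; rewrite /lc_unit /=; apply/eqP => e0.
have : (c ^+ 2 - d ^+ 2) * (a ^+ 2 - b ^+ 2) =
  (c * a + d * b) ^+ 2 - (c * b + a * d) ^+ 2 by ring.
by rewrite e0 e1 e2 mulr0 expr1n expr0n subr0 => /esym/eqP; rewrite oner_eq0.
Qed.
Fact lc_inv_out : {in [predC lc_unit], lc_inv =1 id}.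
Proof.
by move=> L; rewrite inE unfold_in /lc_inv /lc_unit => /negbTE ->.
Qed.

HB.instance Definition _ := GRing.ComNzRing_hasMulInverse.Build (LC2 R)
  lc_mulV lc_unitP lc_inv_out.

Fact lc_scaleA a b L : lc_scale a (lc_scale b L) = lc_scale (a * b) L.
Proof. by congr Lc; exact: mulrA. Qed.
Fact lc_scale1 : left_id 1 lc_scale.
Proof. by move=> [a b]; congr Lc; exact: mul1r. Qed.
Fact lc_scaleDr : right_distributive lc_scale +%R.
Proof. by move=> a L M; congr Lc; exact: mulrDr. Qed.
Fact lc_scaleDl L : {morph lc_scale^~ L : a b / a + b}.
Proof. by move=> a b; congr Lc; exact: mulrDl. Qed.

HB.instance Definition _ := GRing.Zmodule_isLmodule.Build R (LC2 R)
  lc_scaleA lc_scale1 lc_scaleDr lc_scaleDl.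

Fact lc_normD L M : lc_norm (L + M) <= lc_norm L + lc_norm M.
Proof.
case: L M => [a b] [c d]; rewrite /lc_norm /=.
set s := Num.sqrt (a ^+ 2 + b ^+ 2); set t := Num.sqrt (c ^+ 2 + d ^+ 2).
have s0 : 0 <= s by exact: sqrtr_ge0.
have t0 : 0 <= t by exact: sqrtr_ge0.
have s2 : s ^+ 2 = a ^+ 2 + b ^+ 2 by rewrite sqr_sqrtr ?addr_ge0 ?sqr_ge0.
have t2 : t ^+ 2 = c ^+ 2 + d ^+ 2 by rewrite sqr_sqrtr ?addr_ge0 ?sqr_ge0.
have cs : a * c + b * d <= s * t.
  apply: le_trans (ler_norm _) _.
  rewrite -(@ler_pXn2r _ 2) ?nnegrE ?mulr_ge0//.
  rewrite real_normK ?num_real// exprMn s2 t2 -subr_ge0.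
  have -> : (a ^+ 2 + b ^+ 2) * (c ^+ 2 + d ^+ 2) - (a * c + b * d) ^+ 2 =
    (a * d - b * c) ^+ 2 by ring.
  exact: sqr_ge0.
rewrite -(@ler_pXn2r _ 2) ?nnegrE ?addr_ge0 ?sqrtr_ge0//.
by rewrite sqr_sqrtr ?addr_ge0 ?sqr_ge0//; nra.
Qed.
Fact lc_normZ a L : lc_norm (a *: L) = `|a| * lc_norm L.
Proof.
case: L => [b c]; rewrite /lc_norm /= !exprMn -mulrDr.
by rewrite sqrtrM ?sqr_ge0// sqrtr_sqr.
Qed.
Fact lc_norm_eq0 L : lc_norm L = 0 -> L = 0.
Proof.
case: L => [a b] /eqP; rewrite sqrtr_eq0 /= => h.
have /andP[/eqP a0 /eqP b0] : (a == 0) && (b == 0).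
  rewrite -[a == 0]sqrf_eq0 -[b == 0]sqrf_eq0 -paddr_eq0 ?sqr_ge0//.
  by rewrite eq_le h addr_ge0 ?sqr_ge0.
by rewrite a0 b0.
Qed.

HB.instance Definition _ := Lmodule_isNormed.Build R (LC2 R)
  lc_normD lc_normZ lc_norm_eq0.

Lemma lcI1 : lcI = 1 :> LC2 R.
Proof. by []. Qed.

Lemma LC2_coordE x y : Lc x y = x *: lcI + y *: lcE.
Proof. by congr Lc => /=; ring. Qed.

Lemma LC2_mulE x1 y1 x2 y2 :
  Lc x1 y1 * Lc x2 y2 = Lc (x1 * x2 + y1 * y2) (x1 * y2 + x2 * y1).
Proof. by []. Qed.

Lemma LC2_normE x y : `|Lc x y| = Num.sqrt (x ^+ 2 + y ^+ 2).
Proof. by []. Qed.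

Lemma LC2_unitE x y : (Lc x y \is a GRing.unit) = (x ^+ 2 - y ^+ 2 != 0).
Proof. by []. Qed.

End Algebra.

Arguments lcI {R}.
Arguments lcE {R}.

Section Operators.
Variable R : realType.
Implicit Types (L M : LC2 R) (g : R -> R).

Definition P2 : set (R -> R) := [set g | forall t, g (t + 2) = g t].

Definition shift1 g : R -> R := fun t => g (t + 1).

Definition lc_op L g : R -> R := fun t => coordI L * g t + coordE L * shift1 g t.

Lemma shift1K g : P2 g -> shift1 (shift1 g) = g.
Proof.
move=> g2; apply/funext => t.
by rewrite /shift1 -addrA (_ : 1 + 1 = 2) ?g2//; ring.
Qed.

Lemma lc_op_P2 L g : P2 g -> P2 (lc_op L g).
Proof. by move=> g2 t; rewrite /lc_op /shift1 addrAC !g2. Qed.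

Lemma lc_op_I g : lc_op lcI g = g.
Proof. by apply/funext => t; rewrite /lc_op /= mul1r mul0r addr0. Qed.

Lemma lc_op_E g : lc_op lcE g = shift1 g.
Proof. by apply/funext => t; rewrite /lc_op /= mul1r mul0r add0r. Qed.

Lemma lc_opD L M g t : lc_op (L + M) g t = lc_op L g t + lc_op M g t.
Proof. by rewrite /lc_op /=; ring. Qed.

Lemma lc_opZ a L g t : lc_op (a *: L) g t = a * lc_op L g t.
Proof. by rewrite /lc_op /=; ring. Qed.

Lemma lc_opM L M g : P2 g -> lc_op (L * M) g = lc_op L (lc_op M g).
Proof.
move=> g2; apply/funext => t; rewrite /lc_op.
have := congr1 (@^~ t) (shift1K g2); rewrite /shift1 /= => ->.
by ring.
Qed.

Lemma lc_op_inj L M : (forall g, P2 g -> lc_op L g = lc_op M g) -> L = M.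
Proof.
case: L M => [a b] [c d] h.
have e1 := congr1 (@^~ 0) (h (fun=> 1) (fun=> erefl)).
have cos2 : P2 (fun t => cos (pi * t)).
  by move=> t; rewrite mulrDr (_ : pi * 2 = pi *+ 2) ?cosD2pi ?mulr_natr.
have e2 := congr1 (@^~ 0) (h _ cos2).
move: e1 e2; rewrite /lc_op /shift1 /= add0r mulr0 !mulr1 cos0 cospi => e1 e2.
by congr Lc; lra.
Qed.

End Operators.

(* The derivative at L0 is the limit of the difference quotient as L tends to
   L0 with L - L0 invertible, i.e. off the lines |y - y0| = |x - x0|. *)
Definition lc_is_derive (R : realType) (f : LC2 R -> LC2 R)
    (L0 l : LC2 R) : Prop :=
  (f L - f L0) * (L - L0)^-1
    @[L --> within [set L | L - L0 \is a GRing.unit] (nbhs L0)] --> l.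

Definition lc_differentiable (R : realType) (f : LC2 R -> LC2 R)
    (L0 : LC2 R) : Prop :=
  exists l : LC2 R, lc_is_derive f L0 l.

(* Meant for open D: f is total, but then only its values on D matter. *)
Definition lc_holomorphic (R : realType) (D : set (LC2 R))
    (f : LC2 R -> LC2 R) : Prop :=
  forall L0, D L0 -> lc_differentiable f L0.

Lemma LC2_open_image (R : realType) (A : set (R * R)) :
  open A -> open (@LC2_of_pair R @` A).
Proof.
move=> oA; rewrite openE => _ [[x y] Axy <-].
have /nbhs_ballP[e /= e0 sA] : nbhs (x, y) A by exact: open_nbhs_nbhs.
apply/nbhs_ballP; exists e => //= -[x' y'].
rewrite -ball_normE /= LC2_normE => lt_e.
have lt1 (s t : R) : `|s| <= Num.sqrt (s ^+ 2 + t ^+ 2).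
  by rewrite -sqrtr_sqr ler_wsqrtr// lerDl sqr_ge0.
exists (x', y') => //; apply: sA; split => /=; rewrite -ball_normE /=.
  exact: le_lt_trans (lt1 _ _) lt_e.
by apply: le_lt_trans lt_e; rewrite [X in Num.sqrt X]addrC; exact: lt1.
Qed.

(* Main.v *)
Require Import Defs.
From mathcomp Require Import all_boot all_order all_algebra.
From mathcomp Require Import ring.
From mathcomp Require Import all_classical all_reals all_analysis.
Import Order.TTheory GRing.Theory Num.Theory.
Import numFieldNormedType.Exports.
Local Open Scope classical_set_scope.
Local Open Scope ring_scope.

(** A line through L0 in the direction of an invertible element e stays off
    the forbidden lines |y - y0| = |x - x0| except at L0 itself, because the
    nonzero multiples h e are invertible.  Restricting the limit that defines
    the derivative l to this line therefore shows that f has the directional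
    derivative l e along e.  Both coordinate axes are such lines: for e = I
    this reads u_x I + v_x E = l, and for e = E it reads u_y I + v_y E = l E.
    Multiplication by E exchanges the two coordinates, so comparing the two
    equations gives u_x = v_y and u_y = v_x. *)

Lemma ler_norm_coordI (R : realType) (L : LC2 R) : `|coordI L| <= `|L|.
Proof.
by case: L => x y; rewrite LC2_normE -sqrtr_sqr ler_wsqrtr// lerDl sqr_ge0.
Qed.

Lemma ler_norm_coordE (R : realType) (L : LC2 R) : `|coordE L| <= `|L|.
Proof.
by case: L => x y; rewrite LC2_normE -sqrtr_sqr ler_wsqrtr// lerDr sqr_ge0.
Qed.

Lemma coordI_continuous (R : realType) : continuous (@coordI R).
Proof.
move=> L; apply/(@cvgrPdist_lt _ _ _ _ (nbhs_filter L)) => e e0.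
apply/nbhs_ballP; exists e => //= M.
by rewrite -ball_normE; apply: le_lt_trans; exact: (ler_norm_coordI _ (L - M)).
Qed.

Lemma coordE_continuous (R : realType) : continuous (@coordE R).
Proof.
move=> L; apply/(@cvgrPdist_lt _ _ _ _ (nbhs_filter L)) => e e0.
apply/nbhs_ballP; exists e => //= M.
by rewrite -ball_normE; apply: le_lt_trans; exact: (ler_norm_coordE _ (L - M)).
Qed.

Lemma lc_scale_unit (R : realType) (h : R) (L : LC2 R) :
  h != 0 -> L \is a GRing.unit -> h *: L \is a GRing.unit.
Proof.
case: L => x y h0; rewrite !LC2_unitE /= => L0.
by rewrite !exprMn -mulrBr mulf_neq0 ?expf_neq0.
Qed.

Lemma lc_scaleAl (R : realType) (h : R) (L M : LC2 R) :
  h *: (L * M) = (h *: L) * M.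
Proof. by case: L M => [a b] [c d]; congr Lc => /=; ring. Qed.

(** The punctured line h |-> h e + L0 approaches L0 through points L with
    L - L0 invertible, so limits taken along such points restrict to it. *)
Lemma cvg_unit_line (R : realType) (L0 e : LC2 R) : e \is a GRing.unit ->
  h *: e + L0 @[h --> (0 : R)^'] -->
    within [set L | L - L0 \is a GRing.unit] (nbhs L0).
Proof.
move=> ue A; rewrite /within /= => nA.
have cv : h *: e + L0 @[h --> (0 : R)^'] --> L0.
  rewrite -[X in _ --> X]add0r -(scale0r e); apply: cvgD; last exact: cvg_cst.
  by apply: cvgZr_tmp; exact: cvg_within.
have nhA : \forall h \near (0 : R)^',
    h *: e + L0 - L0 \is a GRing.unit -> A (h *: e + L0) := cv _ nA.
apply: filterS2 nhA (nbhs_dnbhs_neq (0 : R)) => h hA h0.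
by apply: hA; rewrite addrK lc_scale_unit.
Qed.

Lemma lc_mulr_continuous (R : realType) (M : LC2 R) :
  continuous (fun L : LC2 R => L * M).
Proof.
(* Splitting L into coordinates makes L * M a sum of scalings of fixed
   vectors, so only the continuity of the two coordinates is involved. *)
have mulE L : L * M = coordI L *: M + coordE L *: (lcE * M).
  by case: L M => [a b] [c d]; congr Lc => /=; ring.
have -> : (fun L => L * M) = (fun L => coordI L *: M + coordE L *: (lcE * M)).
  exact/funext.
move=> L; apply: (@cvgD _ _ _ _ (nbhs_filter L)).
  by apply: (@cvgZr_tmp _ _ _ _ (nbhs_filter L)); exact: coordI_continuous.
by apply: (@cvgZr_tmp _ _ _ _ (nbhs_filter L)); exact: coordE_continuous.
Qed.

(** Along the line L - L0 = h e, and multiplying the difference quotient by e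
    cancels its factor (h e)^-1 up to h^-1. *)
Lemma lc_is_derive_dir (R : realType) (f : LC2 R -> LC2 R) (L0 l e : LC2 R) :
  lc_is_derive f L0 l -> e \is a GRing.unit ->
  h^-1 *: (f (h *: e + L0) - f L0) @[h --> (0 : R)^'] --> l * e.
Proof.
move=> fl ue.
have q : (f (h *: e + L0) - f L0) * (h *: e + L0 - L0)^-1 * e
    @[h --> (0 : R)^'] --> l * e.
  apply: (@cvg_comp _ _ _ (fun h : R =>
    (f (h *: e + L0) - f L0) * (h *: e + L0 - L0)^-1) (fun L => L * e)
    _ (nbhs l)); last exact: lc_mulr_continuous.
  exact: cvg_comp (cvg_unit_line R L0 e ue) fl.
apply: cvg_trans q; apply: near_eq_cvg.
apply: filterS (nbhs_dnbhs_neq (0 : R)) => h h0.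
have uhe := lc_scale_unit R h e h0 ue.
rewrite addrK; set d := f _ - f L0.
rewrite -[in RHS](divrK uhe d) [in RHS](mulrC (d / _)) -lc_scaleAl scalerA.
by rewrite mulVf // scale1r mulrC.
Qed.

(** Taking coordinates is linear and continuous, so the directional derivative
    of f passes to its components.  Openness of Omega matters because f is tied
    to u and v only there: a short segment around p must stay in Omega. *)
Lemma lc_components_cvg (R : realType) (Omega : set (R * R))
    (f : LC2 R -> LC2 R) (u v : R * R -> R) (p : R * R) (l : LC2 R) (a b : R) :
  open Omega -> Omega p ->
  (forall q, Omega q -> f (LC2_of_pair q) = Lc (u q) (v q)) ->
  lc_is_derive f (LC2_of_pair p) l -> Lc a b \is a GRing.unit ->
  h^-1 *: (u (h *: (a, b) + p) - u p) @[h --> (0 : R)^'] -->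
    coordI (l * Lc a b) /\
  h^-1 *: (v (h *: (a, b) + p) - v p) @[h --> (0 : R)^'] -->
    coordE (l * Lc a b).
Proof.
move=> oO Op fE fl ue.
have near_fE : \forall h \near (0 : R)^',
    f (h *: Lc a b + LC2_of_pair p) =
      Lc (u (h *: (a, b) + p)) (v (h *: (a, b) + p)).
  have cv : h *: (a, b) + p @[h --> (0 : R)^'] --> p.
    rewrite -[X in _ --> X]add0r -(scale0r (a, b)).
    apply: cvgD; last exact: cvg_cst.
    by apply: cvgZr_tmp; exact: cvg_within.
  have nO : \forall h \near (0 : R)^', Omega (h *: (a, b) + p).
    by apply: cv; exact: open_nbhs_nbhs.
  by apply: filterS nO => h /fE.
have q := lc_is_derive_dir R f _ l _ fl ue.
split.
- apply: cvg_trans (cvg_comp _ _ q (coordI_continuous R _)).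
  apply: near_eq_cvg; apply: filterS near_fE => h /= ->.
  by rewrite fE.
- apply: cvg_trans (cvg_comp _ _ q (coordE_continuous R _)).
  apply: near_eq_cvg; apply: filterS near_fE => h /= ->.
  by rewrite fE.
Qed.

Theorem theorem4p16 (R : realType) (Omega : set (R * R))
    (f : LC2 R -> LC2 R) (u v : R * R -> R)
    (openOmega : open Omega)
    (fE : forall x y : R, Omega (x, y) ->
      f (x *: lcI + y *: lcE) = u (x, y) *: lcI + v (x, y) *: lcE)
    (holf : lc_holomorphic (@LC2_of_pair R @` Omega) f) :
  forall p : R * R, Omega p ->
    [/\ derivable u p (1, 0), derivable u p (0, 1),
        derivable v p (1, 0) & derivable v p (0, 1)] /\
    'D_(1, 0) u p = 'D_(0, 1) v p /\ 'D_(0, 1) u p = 'D_(1, 0) v p.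
Proof.
move=> p Op.
have fLc q : Omega q -> f (LC2_of_pair q) = Lc (u q) (v q).
  by case: q => x y /fE; rewrite -!LC2_coordE.
have [l fl] : lc_differentiable f (LC2_of_pair p) by apply: holf; exists p.
have partials a b :=
  lc_components_cvg R Omega f u v p l a b openOmega Op fLc fl.
have uI : Lc 1 0 \is a @GRing.unit (LC2 R).
  by rewrite LC2_unitE expr1n expr0n subr0 oner_eq0.
have uE : Lc 0 1 \is a @GRing.unit (LC2 R).
  by rewrite LC2_unitE expr1n expr0n sub0r oppr_eq0 oner_eq0.
have [ux vx] := partials _ _ uI; have [uy vy] := partials _ _ uE.
split; first by split; apply/cvg_ex; eexists; eassumption.
rewrite /derive (cvg_lim _ ux) // (cvg_lim _ vy) // (cvg_lim _ uy) //.
rewrite (cvg_lim _ vx) //=.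
by split; ring.
Qed.
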